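(* Let $k$ be a positive integer. There is a constant $\varepsilon=\Omega_k(1)>0$ (depending only on $k$) such that any algorithm for testing $k$-occurrence-freeness with proximity parameter $\varepsilon$ requires at least $\Omega(n^{1-1/k})$ queries, where $n$ is the length of the input sequence.
   Context: The input is a sequence $A$ of $n$ integers, each entry from $[n]=\{1,\dots,n\}$, with the promise that each value occurs at most $k$ times in $A$. $A$ is $k$-occurrence-free if no value occurs exactly $k$ times in $A$. $A$ is $\varepsilon$-far from $k$-occurrence-free if more than $\varepsilon n$ entries of $A$ must be changed to make it $k$-occurrence-free. A testing algorithm may query the value at any position of $A$; it must accept every $k$-occurrence-free sequence with probability at least $2/3$ and reject every sequence that is $\varepsilon$-far from $k$-occurrence-free with probability at least $2/3$.
   Formalization: Proved for k ≥ 2 only: for k = 1 the promise forces a permutation, which is never 1-occurrence-free, so always rejecting with 0 queries is a valid tester and the Ω(1) bound fails; the constant in Ω(n^{1-1/k}) may depend on k. *)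

(* Defs.v *)
From HB Require Import structures.
From mathcomp Require Import all_boot all_order all_algebra.
From mathcomp Require Import reals exp.
Set Implicit Arguments. Unset Strict Implicit. Unset Printing Implicit Defensive.
Import Order.TTheory GRing.Theory Num.Theory.
Local Open Scope ring_scope.

(* Inputs: sequences of length n with entries in [n]; we index positions and
   values by 'I_n = {0,...,n-1} (a relabelling of [n] = {1,...,n}). *)
Definition input (n : nat) := {ffun 'I_n -> 'I_n}.

Definition occ n (A : input n) (v : 'I_n) : nat := #|[set i | A i == v]|.

Definition promise (k : nat) n (A : input n) : Prop := forall v, (occ A v <= k)%N.

Definition kfree (k : nat) n (A : input n) : Prop := forall v, occ A v <> k.

Definition hdist n (A B : input n) : nat := #|[set i | A i != B i]|.

Definition eps_far (R : realType) (k : nat) (eps : R) n (A : input n) : Prop :=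
  forall B : input n, kfree k B -> eps * n%:R < (hdist A B)%:R.

(* Deterministic adaptive query algorithms = decision trees: query a position,
   branch on the value read; leaves output accept (true) / reject (false). *)
Inductive qtree (n : nat) : Type :=
| Leaf of bool
| Query of 'I_n & ('I_n -> qtree n).

Fixpoint run n (t : qtree n) (A : input n) : bool :=
  match t with
  | Leaf b => b
  | Query i f => run (f (A i)) A
  end.

Fixpoint depth_le n (q : nat) (t : qtree n) : bool :=
  match t with
  | Leaf _ => true
  | Query _ f => if q is q'.+1 then [forall v, depth_le q' (f v)] else false
  end.

(* A randomized algorithm is a finite probability distribution over
   deterministic decision trees (any randomized algorithm making at most q
   queries induces such a distribution over the finitely many trees of
   depth <= q): tree T j is run with probability w j, for j : 'I_m. *)
Definition is_distr (R : realType) m (w : 'I_m -> R) : Prop :=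
  (forall j, 0 <= w j) /\ \sum_(j < m) w j = 1.

Definition acc_prob (R : realType) n m (w : 'I_m -> R) (T : 'I_m -> qtree n)
    (A : input n) : R :=
  \sum_(j < m) w j * (run (T j) A)%:R.

Definition is_tester (R : realType) (k : nat) (eps : R) n (q : nat)
    m (w : 'I_m -> R) (T : 'I_m -> qtree n) : Prop :=
  [/\ is_distr w,
      (forall j, depth_le q (T j)),
      (forall A : input n, promise k A -> kfree k A -> 2 / 3 <= acc_prob w T A) &
      (forall A : input n, promise k A -> eps_far k eps A ->
         2 / 3 <= 1 - acc_prob w T A)].

(* Main.v *)
Require Import Defs.
From HB Require Import structures.
From mathcomp Require Import all_boot all_order all_algebra.
From mathcomp Require Import perm zify lra.
From mathcomp Require Import reals exp.
Set Implicit Arguments. Unset Strict Implicit. Unset Printing Implicit Defensive.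
Import Order.TTheory GRing.Theory Num.Theory.
Local Open Scope nat_scope.

(* Each group of k * 2^k slots, indexed by pairs (j, J) with J in {0,1}^k, carries
   a secret word D in {0,1}^k. For J of even parity, the slots (j, J) with
   J_j = D_j share a common value; all other slots get values of their own. The
   common value of J thus occurs |{j : J_j = D_j}| times, which is k exactly when
   J = D: some value occurs k times iff D has even parity. An input consists of
   about n / (k 2^k) groups whose slots are placed at the positions by a uniformly
   random permutation. The content of a slot (j, J) depends on the bit D_j only, so
   as long as in every group some coordinate j is not seen, flipping D at that
   coordinate changes the parity but not the view of the algorithm. Whatever the
   algorithm does, k given slots are all queried with probability O_k((q/n)^k), and
   there are O_k(n) ways to see all k coordinates of a group, so distinguishing the
   two parities needs q^k = Omega_k(n^(k-1)). *)

(** * How likely a decision tree is to read given slots *)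

Section Queries.
Variable n : nat.

Fixpoint queried (t : qtree n) (A : input n) : {set 'I_n} :=
  match t with
  | Leaf _ => set0
  | Query i f => i |: queried (f (A i)) A
  end.

Lemma eq_in_queried (t : qtree n) (A B : input n) :
  {in queried t A, A =1 B} -> run t A = run t B /\ queried t A = queried t B.
Proof.
elim: t => [b|i f IH] //= eqAB.
have <- : A i = B i by apply: eqAB; rewrite setU11.
have [|-> ->] // := IH (A i).
by move=> p pQ; apply: eqAB; rewrite inE pQ orbT.
Qed.

Definition agree (Z : {set 'I_n}) (s0 s : {perm 'I_n}) : bool :=
  [forall p in Z, s p == s0 p].

(** Composing with the inverse of [s0] turns these permutations into ones that fix [Z] pointwise. *)
Lemma card_agree (Z : {set 'I_n}) (s0 : {perm 'I_n}) :
  #|[set s | agree Z s0 s]| <= (n - #|Z|)`!.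
Proof.
have -> : n - #|Z| = #|~: Z| by rewrite [RHS]cardsCs setCK card_ord.
rewrite -card_perm.
rewrite -(card_imset _ (mulIg (s0^-1)%g)).
apply/subset_leq_card/subsetP => _ /imsetP[s + ->].
rewrite inE => /forall_inP ag; rewrite unfold_in; apply/subsetP => p.
rewrite !inE permM; apply: contra => pZ.
by rewrite (eqP (ag p pZ)) permK.
Qed.

(** Two terms of the binomial expansion. In the induction on trees they stand for a query that hits
    one of [m] target slots and for one that misses them all. *)
Lemma leq_binomial_step q m : m * q ^ m.-1 + q ^ m <= q.+1 ^ m.
Proof.
case: m => [|m]; first by rewrite mul0n !expn0.
elim: m => [|m IH]; first by rewrite !expn1 expn0 mul1n add1n.
rewrite [q.+1 ^ _]expnS; apply: leq_trans (leq_mul (leqnn _) IH) => /=.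
rewrite !expnS; move: (q ^ m) => X; nia.
Qed.

(* Adaptivity does not help: conditioned on the answers [s0] on [Z], a query
   outside [Z] returns a uniformly random new slot. *)
Lemma card_queried_conditioned (F : 'I_n -> 'I_n) (q : nat) (t : qtree n)
    (Z K : {set 'I_n}) (s0 : {perm 'I_n}) :
  depth_le q t -> [disjoint K & s0 @: Z] ->
  #|[set s | agree Z s0 s &&
       (K \subset s @: queried t [ffun p => F (s p)])]|
    <= q ^ #|K| * (n - #|Z| - #|K|)`!.
Proof.
elim: t q Z K s0 => [b|p f IH] q Z K s0 /= dq disK.
  have [->|/set0Pn[x xK]] := eqVneq K set0.
    rewrite cards0 expn0 mul1n subn0; apply: leq_trans (card_agree Z s0).
    by apply/subset_leq_card/subsetP => s; rewrite !inE => /andP[].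
  rewrite (_ : [set _ | _] = set0) ?cards0 //; apply/setP => s.
  rewrite !inE imset0; apply/negP => /andP[_ /subsetP/(_ x xK)].
  by rewrite inE.
case: q dq => [//|q] /forallP dq.
(* A repeated query reads a slot in [s0 @: Z], hence none of [K]. *)
have [pZ|pZ] := boolP (p \in Z).
  apply: (@leq_trans (q ^ #|K| * (n - #|Z| - #|K|)`!)); last first.
    by rewrite leq_mul2r (leq_trans _ (leq_binomial_step q _)) ?orbT ?leq_addl.
  apply: leq_trans (IH (F (s0 p)) q Z K s0 (dq _) disK).
  apply/subset_leq_card/subsetP => s; rewrite !inE => /andP[ag sub].
  rewrite ag /=; move/forall_inP: (ag) => /(_ p pZ)/eqP sp.
  apply/subsetP => x xK; move/subsetP: sub => /(_ x xK).
  rewrite ffunE sp => /imsetP[y]; rewrite !inE => /orP[/eqP->|yQ] xE.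
    move/pred0P: disK => /(_ x) /=; rewrite xK /= xE sp.
    by rewrite imset_f.
  by rewrite xE imset_f.
pose X := [set s | agree Z s0 s &&
       (K \subset s @: (p |: queried (f ([ffun r => F (s r)] p)) [ffun r => F (s r)]))].
rewrite -/X.
have XE : #|X| = \sum_(y : 'I_n) #|[set s in X | s p == y]|.
  rewrite -sum1_card (partition_big (fun s : {perm 'I_n} => s p) predT) //=.
  by apply: eq_bigr => y _; rewrite -sum1_card; apply: eq_bigl => s; rewrite !inE.
have cU : #|p |: Z| = #|Z|.+1 by rewrite cardsU1 pZ.
(* Split by the slot [y] found at [p]: a slot already read cannot recur, a slot of [K] leaves one
   target fewer, any other slot leaves [K] as it is. A member [s1] of the class serves as the new
   record of answers. *)
have Xy y : #|[set s in X | s p == y]| <=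
    if y \in s0 @: Z then 0 else
    if y \in K then q ^ #|K|.-1 * (n - #|Z| - #|K|)`!
    else q ^ #|K| * (n - #|Z| - #|K|).-1`!.
  have [->|/set0Pn[s1]] := eqVneq [set s in X | s p == y] set0.
    by rewrite cards0.
  rewrite !inE => /andP[/andP[ag1 sub1] /eqP s1p].
  have im1 : s1 @: Z = s0 @: Z.
    by apply: eq_in_imset => r rZ; apply/eqP; apply: (forall_inP ag1).
  have -> : (y \in s0 @: Z) = false.
    apply/negbTE; rewrite -im1 -s1p (mem_imset _ _ (@perm_inj _ s1)).
    exact: pZ.
  have disKy : [disjoint K :\ y & s1 @: (p |: Z)].
    rewrite imsetU1 im1 s1p; apply/pred0P => x /=; rewrite !inE.
    have [//|/= xy] := eqVneq x y.
    by move/pred0P: disK => /(_ x).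
  have := IH (F y) q (p |: Z) (K :\ y) s1 (dq _) disKy.
  have -> : (if y \in K then q ^ #|K|.-1 * (n - #|Z| - #|K|)`!
    else q ^ #|K| * (n - #|Z| - #|K|).-1`!)
     = q ^ #|K :\ y| * (n - #|p |: Z| - #|K :\ y|)`!.
    rewrite cU (cardsD1 y K); case: (y \in K); rewrite ?add1n ?add0n /=;
      by congr (_ * _`!); lia.
  apply: leq_trans; apply/subset_leq_card/subsetP => s.
  rewrite !inE => /andP[/andP[ag sub] /eqP sp].
  apply/andP; split.
    apply/forall_inP => r; rewrite !inE => /orP[/eqP->|rZ]; first by rewrite sp s1p.
    by rewrite (eqP (forall_inP ag r rZ)) eq_sym (forall_inP ag1 r rZ).
  apply/subsetP => x; rewrite !inE => /andP[xy xK].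
  move/subsetP: sub => /(_ x xK); rewrite ffunE sp => /imsetP[r].
  rewrite !inE => /orP[/eqP->|rQ] xE; last by rewrite xE imset_f.
  by rewrite xE sp eqxx in xy.
rewrite XE; apply: leq_trans (@leq_sum _ _ xpredT _ _ (fun y _ => Xy y)) _.
rewrite (bigID (fun y => y \in s0 @: Z)) /= big1 ?add0n => [|y ->//].
rewrite (bigID (fun y => y \in K)) /=.
rewrite (eq_bigr (fun=> q ^ #|K|.-1 * (n - #|Z| - #|K|)`!)); last first.
  by move=> y /andP[/negbTE-> ->].
rewrite [X in _ + X](eq_bigr (fun=> q ^ #|K| * (n - #|Z| - #|K|).-1`!)); last first.
  by move=> y /andP[/negbTE-> /negbTE->].
rewrite !sum_nat_const.
have -> : #|[pred y | (y \notin s0 @: Z) && (y \in K)]| = #|K|.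
  apply: eq_card => y; rewrite !inE andbC; have [yK|] //= := boolP (y \in K).
  by rewrite (disjointFr disK yK).
have -> : #|[pred y | (y \notin s0 @: Z) && (y \notin K)]| = n - #|Z| - #|K|.
  rewrite -(card_imset Z (@perm_inj _ s0)) -subnDA.
  have <- : #|s0 @: Z :|: K| = #|s0 @: Z| + #|K|.
    by rewrite cardsU setIC disjoint_setI0 // cards0 subn0.
  have := cardsC (s0 @: Z :|: K); rewrite card_ord => cE.
  suff -> : #|[pred y | (y \notin s0 @: Z) && (y \notin K)]| =
            #|~: (s0 @: Z :|: K)| by lia.
  by apply: eq_card => y; rewrite !inE negb_or.
set a := n - #|Z| - #|K|.
apply: leq_trans (leq_mul (leq_binomial_step q #|K|) (leqnn a`!)).
rewrite mulnDl mulnA leq_add2l.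
rewrite mulnCA leq_mul2l; case: a => [|a]; first by rewrite mul0n orbT.
by rewrite factS leqnn orbT.
Qed.

Lemma card_queried_slots (F : 'I_n -> 'I_n) (q : nat) (t : qtree n)
    (K : {set 'I_n}) :
  depth_le q t ->
  #|[set s : {perm 'I_n} | K \subset s @: queried t [ffun p => F (s p)]]|
    <= q ^ #|K| * (n - #|K|)`!.
Proof.
move=> dq; have := @card_queried_conditioned F q t set0 K 1%g dq.
rewrite imset0 disjoint_sym disjoints_subset sub0set cards0 subn0 => /(_ isT).
apply: leq_trans; apply/subset_leq_card/subsetP => s; rewrite !inE => ->.
by rewrite andbT; apply/forall_inP => p; rewrite inE.
Qed.

End Queries.

(** * One group of slots and its secret word *)

Section Gadget.
Variable k' : nat.
Notation k := k'.+2.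
Notation word := {ffun 'I_k -> bool}.

Definition parity (J : word) : bool := \big[addb/false]_j J j.

Definition flip (i : 'I_k) (J : word) : word := [ffun j => J j (+) (j == i)].

Lemma flipK i : involutive (flip i).
Proof. by move=> J; apply/ffunP => j; rewrite !ffunE -addbA addbb addbF. Qed.

Lemma flipC i i' J : flip i (flip i' J) = flip i' (flip i J).
Proof. by apply/ffunP => j; rewrite !ffunE addbAC. Qed.

Lemma parity_flip i J : parity (flip i J) = ~~ parity J.
Proof.
rewrite /parity; under eq_bigr do rewrite ffunE.
rewrite big_split /= [X in _ (+) X](bigD1 i) //= eqxx.
by rewrite [X in _ (+) (_ (+) X)]big1 ?addbT // => j /negbTE.
Qed.

(** Flipping [j] together with a second coordinate changes bit [j] but not the parity; at least two
    coordinates exist. *)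
Definition partner (j : 'I_k) : 'I_k := if j == ord0 then inord 1 else ord0.

Lemma partner_neq j : (j == partner j) = false.
Proof.
rewrite /partner; case: (eqVneq j ord0) => [->|/negbTE] //.
by apply/eqP => /(congr1 val); rewrite /= inordK.
Qed.

Definition flip2 (j : 'I_k) (J : word) : word := flip j (flip (partner j) J).

Lemma flip2K j : involutive (flip2 j).
Proof. by move=> J; rewrite /flip2 [flip (partner j) (flip j _)]flipC !flipK. Qed.

Lemma parity_flip2 j J : parity (flip2 j J) = parity J.
Proof. by rewrite !parity_flip negbK. Qed.

Lemma flip2E j J : flip2 j J j = ~~ J j.
Proof. by rewrite !ffunE eqxx partner_neq addbF addbT. Qed.

(* The even words [J] and [flip2 j J] can share a name for their singletons
   at coordinate [j], since exactly one of them agrees with [D] there; this frees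
   the names [(j, J)] with [J j = true] for the values [common_value]. *)
Definition single_value (j : 'I_k) (J : word) : 'I_k * word :=
  (j, if J j then flip2 j J else J).

Definition common_value (J : word) : 'I_k * word :=
  if J ord0 then (ord0, J) else
  let o := partner ord0 in (o, if J o then J else flip2 o J).

Definition gadget (D : word) (x : 'I_k * word) : 'I_k * word :=
  if parity x.2 then x
  else if x.2 x.1 == D x.1 then common_value x.2 else single_value x.1 x.2.

Lemma eq_gadget (D D' : word) (x : 'I_k * word) :
  D x.1 = D' x.1 -> gadget D x = gadget D' x.
Proof. by rewrite /gadget => ->. Qed.

Lemma parity_common J : parity (common_value J).2 = parity J.
Proof.
by rewrite /common_value; do 2?case: ifP => //= _; rewrite parity_flip2.
Qed.

Lemma parity_single j J : parity (single_value j J).2 = parity J.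
Proof. by rewrite /single_value /=; case: ifP => //= _; rewrite parity_flip2. Qed.

Lemma common_bit J : (common_value J).2 (common_value J).1.
Proof.
rewrite /common_value; case: ifP => //= _; case: ifP => //= Jo.
by rewrite flip2E Jo.
Qed.

Lemma single_bit j J : (single_value j J).2 (single_value j J).1 = false.
Proof.
by rewrite /single_value /=; case: ifP => //= Jj; rewrite flip2E Jj.
Qed.

Lemma flip2_partner0 J :
  flip2 (partner ord0) J ord0 = ~~ J ord0.
Proof.
rewrite /flip2 !ffunE partner_neq.
have -> : partner (partner ord0) = ord0 by rewrite {1}/partner eq_sym partner_neq.
by rewrite eqxx addbT addbF.
Qed.

(** The coordinate in the name gives bit 0 of [J]. If that bit is false, [flip2 o] would set it, so
    bit 0 of the named word tells whether a flip took place. *)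
Lemma common_value_inj : injective common_value.
Proof.
move=> J J'; rewrite /common_value; set o := partner ord0.
have no : ord0 == o = false by exact: partner_neq.
case J0: (J ord0); case J'0: (J' ord0) => /=.
- by case.
- by case=> /eqP; rewrite no.
- by case=> /eqP; rewrite eq_sym no.
case Jo: (J o); case J'o: (J' o) => /= -[E] //.
- by move: J0; rewrite E flip2_partner0 J'0.
- by move: J'0; rewrite -E flip2_partner0 J0.
exact: (can_inj (flip2K o)) E.
Qed.

Lemma single_value_inj j (J J' : word) :
  J j = J' j -> single_value j J = single_value j J' -> J = J'.
Proof.
rewrite /single_value => <-; case: ifP => _ [] //.
exact: (can_inj (flip2K j)).
Qed.

(** The word in a value is odd for a fixed slot; if it is even, its bit at the named coordinate is
    true for a common value and false for a single one. So the three cases of [gadget] never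
    collide. *)
Lemma gadget_fiber (D : word) (v : 'I_k * word) :
  #|[set x | gadget D x == v]| <= 1 \/
  exists2 J, ~~ parity J &
    [set x | gadget D x == v] \subset [set (j, J) | j in [set j | J j == D j]].
Proof.
set X := [set x | _].
have [->|/set0Pn[x0 x0X]] := eqVneq X set0; first by left; rewrite cards0.
move: (x0X); rewrite inE /gadget.
case: ifP => [p0|p0]; last case: ifP => [a0|a0]; move=> /eqP v0.
- left; rewrite -(cards1 x0); apply/subset_leq_card/subsetP => x.
  rewrite !inE -v0 /gadget; case: ifP => // px.
  by case: ifP => _ /eqP e; move: p0; rewrite -e ?parity_common ?parity_single px.
- right; exists x0.2; rewrite ?p0 //; apply/subsetP => x.
  rewrite !inE -v0 /gadget; case: ifP => [px /eqP e|px].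
    by move: px; rewrite e parity_common p0.
  case: ifP => [ax /eqP/common_value_inj e|_ /eqP e].
    by apply/imsetP; exists x.1; rewrite ?inE -e // -surjective_pairing.
  by have := common_bit x0.2; rewrite -e single_bit.
left; rewrite -(cards1 x0); apply/subset_leq_card/subsetP => x.
rewrite !inE -v0 /gadget; case: ifP => [px /eqP e|px].
  by move: px; rewrite e parity_single p0.
case: ifP => [_ /eqP e|ax /eqP e].
  by have := common_bit x.2; rewrite e single_bit.
have e1 : x.1 = x0.1 by case: e.
rewrite [x]surjective_pairing [x0]surjective_pairing e1.
apply/eqP; congr pair; apply: (@single_value_inj x0.1); last by rewrite -{1}e1.
(* Both words disagree with [D] at this coordinate, so they have the same bit there. *)
move: ax a0; rewrite e1.
by case: (x.2 _); case: (x0.2 _); case: (D _).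
Qed.

Lemma card_gadget_le (D : word) v : #|[set x | gadget D x == v]| <= k.
Proof.
have [le1|[J _ /subset_leq_card le]] := gadget_fiber D v;
  first exact: leq_trans le1 _.
apply: leq_trans le _; apply: leq_trans (leq_imset_card _ _) _.
by rewrite -[X in _ <= X]card_ord max_card.
Qed.

Lemma card_gadget_lt (D : word) v :
  parity D -> #|[set x | gadget D x == v]| < k.
Proof.
move=> pD; have [le1|[J pJ /subset_leq_card le]] := gadget_fiber D v;
  first exact: leq_ltn_trans le1 _.
apply: leq_ltn_trans le _; apply: leq_ltn_trans (leq_imset_card _ _) _.
rewrite -[X in _ < X]card_ord -cardsT proper_card // properT.
(* [J] is even and [D] is odd, so they differ somewhere. *)
apply: contraNneq pJ => JD; suff -> : J = D by [].
by apply/ffunP => j; apply/eqP; move/setP: JD => /(_ j); rewrite !inE.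
Qed.

Lemma card_gadget_common (D : word) :
  ~~ parity D -> #|[set x | gadget D x == common_value D]| = k.
Proof.
move=> pD; apply/eqP; rewrite eqn_leq card_gadget_le /=.
rewrite -[X in X <= _](card_ord k).
have inj : injective (fun j : 'I_k => (j, D)) by move=> j j' [].
rewrite -(card_codom inj) subset_leq_card //; apply/subsetP => _ /codomP[j ->].
by rewrite !inE /gadget /= (negbTE pD) !eqxx.
Qed.

End Gadget.

(** Each factor of the falling factorial is at least [n / 2]. *)
Lemma leq_expn_ffact n k : 2 * k <= n -> n ^ k <= 2 ^ k * n ^_ k.
Proof.
elim: k => [|k IH] kn; first by rewrite ffactn0.
rewrite ffactnSr !expnSr mulnACA leq_mul ?IH //; lia.
Qed.

(** * The hard inputs: promise and distance *)

Section HardInputs.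
Variables (k' M r n : nat).
Notation k := k'.+2.
Notation word := {ffun 'I_k -> bool}.
Notation slot := (('I_M * ('I_k * word)) + 'I_r)%type.
Notation secret := {ffun 'I_M -> word}.
Hypothesis cardE : #|{: slot}| = n.

(** Slots label both the permuted positions and the values; the [r] filler slots bring their number
    to exactly [n]. *)
Definition enc (s : slot) : 'I_n := cast_ord cardE (enum_rank s).
Definition dec (p : 'I_n) : slot := enum_val (cast_ord (esym cardE) p).

Lemma encK : cancel enc dec.
Proof. by move=> s; rewrite /enc /dec cast_ordK enum_rankK. Qed.

Lemma decK : cancel dec enc.
Proof. by move=> p; rewrite /enc /dec enum_valK cast_ordKV. Qed.

Definition blocks (D : secret) (s : slot) : slot :=
  match s with
  | inl (g, x) => inl (g, gadget (D g) x)
  | inr i => inr i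
  end.

Definition hard (D : secret) (s : {perm 'I_n}) : input n :=
  [ffun p => enc (blocks D (dec (s p)))].

Lemma occ_hard D s (v : slot) :
  occ (hard D s) (enc v) = #|[set x | blocks D x == v]|.
Proof.
have bij : bijective (fun p => dec (s p)).
  exists (fun x => (s^-1)%g (enc x)) => x; first by rewrite decK permK.
  by rewrite permKV encK.
rewrite -(on_card_preimset (onW_bij _ bij)); apply: eq_card => p.
by rewrite !inE ffunE (can_eq encK).
Qed.

Lemma occ_hard_inl D s g x :
  occ (hard D s) (enc (inl (g, x))) = #|[set y | gadget (D g) y == x]|.
Proof.
have inj : injective (fun y : 'I_k * word => inl (g, y) : slot) by move=> y y' [].
rewrite occ_hard -(card_imset _ inj); apply: eq_card => -[[h y]|i]; rewrite !inE.
  apply/eqP/imsetP => [[<- /= <-]|[z]]; first by exists y; rewrite ?inE.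
  by rewrite inE => /eqP <- [-> ->].
by apply/esym/imsetP => -[].
Qed.

Lemma occ_hard_inr D s i : occ (hard D s) (enc (inr i)) = 1.
Proof.
rewrite occ_hard -(cards1 (inr i : slot)); apply: eq_card => -[[h y]|j].
  by rewrite !inE.
by rewrite !inE.
Qed.

Definition has_parity (b : bool) (D : secret) := [forall g, parity (D g) == b].

Lemma promise_hard D s : promise k (hard D s).
Proof.
move=> v; rewrite -(decK v); case: (dec v) => [[g x]|i].
  by rewrite occ_hard_inl card_gadget_le.
by rewrite occ_hard_inr.
Qed.

Lemma kfree_hard D s : has_parity true D -> kfree k (hard D s).
Proof.
move=> /forallP oD v; rewrite -(decK v); case: (dec v) => [[g x]|i].
  by rewrite occ_hard_inl => e; have := card_gadget_lt x (eqP (oD g)); rewrite e ltnn.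
by rewrite occ_hard_inr.
Qed.

(* A single change can repair two groups, by removing the common value of one and
   adding that of the other: [kfree] allows [k.+1] occurrences. *)
Lemma hdist_hard D s (B : input n) :
  has_parity false D -> kfree k B -> M <= 2 * hdist (hard D s) B.
Proof.
move=> /forallP eD kB; set A := hard D s.
pose v g := enc (inl (g, common_value (D g))).
have vinj : injective v by move=> g h /(can_inj encK)[].
rewrite -[X in X <= _](card_ord M) -(card_imset _ vinj) mul2n -addnn.
(* A common value that is neither an old nor a new entry at a changed position would still occur [k]
   times in [B]. *)
apply: (@leq_trans #|(A @: [set i | A i != B i]) :|: (B @: [set i | A i != B i])|).
  apply/subset_leq_card/subsetP => _ /imsetP[g _ ->].
  apply: contraT => ng; case: (kB (v g)).
  have <- : occ A (v g) = k.
    by rewrite occ_hard_inl card_gadget_common // (eqP (eD g)).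
  apply: eq_card => i; rewrite !inE.
  have [->//|nAB] := eqVneq (A i) (B i).
  have iH : i \in [set i | A i != B i] by rewrite inE.
  move: ng; rewrite inE negb_or => /andP[nA nB].
  have -> : (A i == v g) = false.
    by apply/negbTE; apply: contraNneq nA => <-; rewrite imset_f.
  by apply/negbTE; apply: contraNneq nB => <-; rewrite imset_f.
apply: leq_trans (leq_card_setU _ _) _.
by rewrite leq_add // leq_imset_card.
Qed.

(** * Exchanging the parities behind an unchanged view *)

Variable t : qtree n.

Definition touched (s : {perm 'I_n}) (D : secret) (g : 'I_M) (j : 'I_k) : bool :=
  [exists J, enc (inl (g, (j, J))) \in s @: queried t (hard D s)].

Definition unexposed (s : {perm 'I_n}) (D : secret) : bool :=
  [forall g, exists j, ~~ touched s D g j].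

(** Fully seen groups stay as they are, which makes this a bijection on all secrets. *)
Definition switch (s : {perm 'I_n}) (D : secret) : secret :=
  [ffun g => if [pick j | ~~ touched s D g j] is Some j then flip j (D g)
             else D g].

Lemma switch_view s D :
  run t (hard D s) = run t (hard (switch s D) s) /\
  queried t (hard D s) = queried t (hard (switch s D) s).
Proof.
apply: eq_in_queried => p pQ; rewrite !ffunE; congr enc.
case Ep: (dec (s p)) => [[g [j J]]|i] //=.
rewrite (@eq_gadget _ (D g) (switch s D g)) //= ffunE.
case: pickP => [i /existsPn/(_ J)|//] ti; rewrite ffunE.
have [ji|] := eqVneq j i; last by rewrite addbF.
by move: ti; rewrite -ji -Ep decK imset_f.
Qed.

(** The queried set is the same after switching, so the second application picks the same
    coordinates. *)
Lemma switchK s : involutive (switch s).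
Proof.
move=> D; apply/ffunP => g; rewrite ffunE.
have tE j : touched s (switch s D) g j = touched s D g j.
  by rewrite /touched (switch_view s D).2.
rewrite (eq_pick (fun j => congr1 negb (tE j))) ffunE.
by case: pickP => // j _; rewrite flipK.
Qed.

Lemma parity_switch s D b :
  unexposed s D -> has_parity b D -> has_parity (~~ b) (switch s D).
Proof.
move=> /forallP uD /forallP pD; apply/forallP => g; rewrite ffunE.
case: pickP => [j _|none]; first by rewrite parity_flip (eqP (pD g)).
by have /existsP[j] := uD g; rewrite none.
Qed.

(** [switch] matches each accepted unexposed odd secret with an accepted even one; the exposed odd
    secrets are paid for by the last sum. *)
Lemma sum_run_hard s :
  \sum_(D | has_parity true D) run t (hard D s) <=
  \sum_(D | has_parity false D) run t (hard D s) +
  \sum_(D | has_parity true D) ~~ unexposed s D.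
Proof.
rewrite [X in _ <= X + _](reindex_inj (can_inj (switchK s))) /=.
rewrite !(big_mkcond (has_parity _)) [X in _ <= X + _]big_mkcond /= -big_split /=.
apply: leq_sum => D _; rewrite -(switch_view s D).1.
case oD: (has_parity true D) => //.
have [uD|] := boolP (unexposed s D); last by case: (run _ _); case: has_parity.
by rewrite (parity_switch uD oD) leq_addr.
Qed.

Lemma card_has_parity :
  #|[pred D | has_parity true D]| = #|[pred D | has_parity false D]|.
Proof.
pose fl (D : secret) : secret := [ffun g => flip ord0 (D g)].
have flK : involutive fl by move=> D; apply/ffunP => g; rewrite !ffunE flipK.
rewrite -!sum1_card (reindex_inj (can_inj flK)); apply: eq_bigl => D.
rewrite !inE; apply: eq_forallb => g; rewrite ffunE parity_flip.
by case: parity.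
Qed.

(** Union bound over the group and over one queried word per coordinate, [2 ^ (k * k)] choices in
    all; each choice fixes [k] slots to be read. *)
Lemma card_exposed q D :
  depth_le q t ->
  #|[set s | ~~ unexposed s D]| <= M * 2 ^ (k * k) * (q ^ k * (n - k)`!).
Proof.
move=> dq.
pose K (c : 'I_M * {ffun 'I_k -> word}) :=
  [set enc (inl (c.1, (j, c.2 j))) | j : 'I_k].
have cK c : #|K c| = k.
  rewrite card_imset ?card_ord // => j j' /(can_inj encK)[-> _]; exact: erefl.
pose X c := [set s : {perm 'I_n} | K c \subset s @: queried t (hard D s)].
apply: (@leq_trans #|\bigcup_c X c|).
  apply/subset_leq_card/subsetP => s; rewrite inE => /forallPn[g].
  move=> /existsPn tg.
  pose Js : {ffun 'I_k -> word} := [ffun j => xchoose (existsP (negbNE (tg j)))].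
  apply/bigcupP; exists (g, Js) => //; rewrite inE; apply/subsetP => _ /imsetP[j _ ->].
  by rewrite /= ffunE; exact: (xchooseP (existsP (negbNE (tg j)))).
apply: (@leq_trans (\sum_(c : 'I_M * {ffun 'I_k -> word}) q ^ k * (n - k)`!)).
  elim/big_ind2: _ => [|a A b B ha hb|c _]; first by rewrite cards0.
    by apply: leq_trans (leq_card_setU _ _) _; apply: leq_add.
  have := card_queried_slots (fun p => enc (blocks D (dec p))) (K c) dq.
  by rewrite cK.
by rewrite sum_nat_const card_prod card_ord !card_ffun card_bool card_ord expnM.
Qed.

Lemma sum_exposed q :
  2 * k <= n -> M <= n -> depth_le q t ->
  (\sum_(s : {perm 'I_n}) \sum_(D | has_parity true D) ~~ unexposed s D) * n ^ k.-1
  <= 2 ^ (k * k + k) * q ^ k * (n`! * #|[pred D | has_parity true D]|).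
Proof.
move=> kn Mn dq; rewrite exchange_big /= big_distrl /=.
rewrite mulnA mulnC -sum_nat_const; apply: leq_sum => D _.
have -> : \sum_(s : {perm 'I_n}) ~~ unexposed s D = #|[set s | ~~ unexposed s D]|.
  rewrite -sum1_card [RHS]big_mkcond /=; apply: eq_bigr => s _.
  by rewrite inE; case: unexposed.
have n0 : 0 < n by lia.
(* An extra factor [n] completes [n ^ k]; the number of groups [M <= n] pays for it. *)
rewrite -(leq_pmul2r n0) -mulnA -expnSr /=.
apply: leq_trans (leq_mul (card_exposed D dq) (leq_expn_ffact kn)) _.
rewrite -(@ffact_fact n k); last by lia.
rewrite expnD.
have -> : M * 2 ^ (k * k) * (q ^ k * (n - k)`!) * (2 ^ k * n ^_ k) =
  2 ^ (k * k) * 2 ^ k * q ^ k * (n ^_ k * (n - k)`!) * M.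
  by move: (2 ^ (k * k)) (2 ^ k) (q ^ k) (n ^_ k) ((n-k)`!) => a b c d e; nia.
by rewrite leq_mul2l Mn orbT.
Qed.

End HardInputs.

(** * Averaging over hard inputs and the lower bound *)

Local Open Scope ring_scope.

Lemma has_parity_inhabited k' M :
  (0 < #|[pred D : {ffun 'I_M -> {ffun 'I_k'.+2 -> bool}} | has_parity true D]|)%N.
Proof.
apply/card_gt0P; exists [ffun=> flip ord0 [ffun=> false]].
rewrite inE; apply/forallP => g; rewrite ffunE parity_flip /parity.
by rewrite big1 // => j _; rewrite ffunE.
Qed.

(** Yao's principle: the mean acceptance probabilities for the two parities differ by at least 1/3,
    but each deterministic tree can separate them only through exposed secrets. *)
Lemma tester_queries (R : realType) (k' M r n : nat)
    (cardE : #|{: 'I_M * ('I_k'.+2 * {ffun 'I_k'.+2 -> bool}) + 'I_r}| = n)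
    (eps : R) (q m : nat) (w : 'I_m -> R) (T : 'I_m -> qtree n) :
  (2 * k'.+2 <= n)%N -> (M <= n)%N ->
  (forall D s, has_parity false D -> eps_far k'.+2 eps (hard cardE D s)) ->
  is_tester k'.+2 eps q w T ->
  n%:R ^+ k'.+1 <= 3 * (2 ^ (k'.+2 * k'.+2 + k'.+2))%:R * q%:R ^+ k'.+2 :> R.
Proof.
move=> kn Mn far [[w0 w1] dT accT rejT].
(* Totals rather than means: both parities have the same number [N] of pairs of a permutation and a
   secret. *)
pose P b := \sum_(s : {perm 'I_n}) \sum_(D | has_parity b D)
  acc_prob w T (hard cardE D s).
pose N : R := (n`! * #|[pred D : {ffun 'I_M -> {ffun 'I_k'.+2 -> bool}} |
                        has_parity true D]|)%:R.
have sumN b (x : R) :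
  \sum_(s : {perm 'I_n})
    \sum_(D : {ffun 'I_M -> {ffun 'I_k'.+2 -> bool}} | has_parity b D) x = N * x.
  rewrite !sumr_const -mulrnA -[x *+ _]mulr_natl /N; congr (_%:R * _).
  rewrite mulnC card_Sn; congr muln.
  by case: b => //; rewrite card_has_parity.
have N0 : 0 < N by rewrite ltr0n muln_gt0 fact_gt0 has_parity_inhabited.
have h1 : N * (2 / 3) <= P true.
  rewrite -(sumN true); apply: ler_sum => s _; apply: ler_sum => D oD.
  by apply: accT; [exact: promise_hard|exact: kfree_hard].
have h2 : P false <= N * (1 / 3).
  rewrite -(sumN false); apply: ler_sum => s _; apply: ler_sum => D eD.
  have := rejT _ (promise_hard cardE D s) (far D s eD); lra.
pose a b j := (\sum_(s : {perm 'I_n}) \sum_(D | has_parity b D)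
    run (T j) (hard cardE D s))%N.
have PE b : P b = \sum_j w j * (a b j)%:R.
  rewrite /P /acc_prob; under eq_bigr do rewrite exchange_big /=.
  rewrite exchange_big /=; apply: eq_bigr => j _.
  rewrite /a natr_sum mulr_sumr; apply: eq_bigr => s _.
  by rewrite natr_sum mulr_sumr.
set C := (2 ^ _)%:R.
have h3 : (P true - P false) * n%:R ^+ k'.+1 <= C * q%:R ^+ k'.+2 * N.
  rewrite !PE -sumrB mulr_suml.
  set z := C * _ * N; have -> : z = \sum_j w j * z by rewrite -mulr_suml w1 mul1r.
  apply: ler_sum => j _.
  rewrite -mulrBr -mulrA; rewrite ler_wpM2l //.
  pose x := (\sum_(s : {perm 'I_n}) \sum_(D | has_parity true D)
    ~~ unexposed cardE (T j) s D)%N.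
  have ax : (a true j <= a false j + x)%N.
    rewrite -big_split /=; apply: leq_sum => s _; exact: sum_run_hard.
  apply: (@le_trans _ _ (x%:R * n%:R ^+ k'.+1)).
    by rewrite ler_wpM2r ?exprn_ge0 // lerBlDl -natrD ler_nat.
  by rewrite /z /C /N -!natrX -!natrM ler_nat; apply: sum_exposed.
have n0 : 0 <= n%:R ^+ k'.+1 :> R by rewrite exprn_ge0.
rewrite -(ler_pM2r N0); move: h3; set y := n%:R ^+ _ in n0 *.
set z := q%:R ^+ _ => h3.
have : N * (1 / 3) * y <= (P true - P false) * y by rewrite ler_wpM2r //; lra.
move=> h4; have := le_trans h4 h3; lra.
Qed.

Theorem theorem3 (R : realType) (k : nat) : (2 <= k)%N ->
  exists eps : R, 0 < eps /\
  exists c : R, 0 < c /\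
  exists N : nat, forall n : nat, (N <= n)%N ->
    forall (q m : nat) (w : 'I_m -> R) (T : 'I_m -> qtree n),
      is_tester k eps q w T ->
      c * powR (n%:R) (1 - (k%:R)^-1) <= q%:R.
Proof.
case: k => [|[|k']] // _; set k := k'.+2.
pose L := (k * 2 ^ k)%N.
have L0 : (0 < L)%N by rewrite muln_gt0 expn_gt0.
pose C : R := 3 * (2 ^ (k * k + k))%:R.
have C0 : 0 < C by rewrite mulr_gt0 // ltr0n expn_gt0.
(* The distance is at least half the number of groups [n %/ L], which exceeds [n / (2 L)] once
   [L <= n]. *)
exists (4 * L%:R)^-1; split; first by rewrite invr_gt0 mulr_gt0 // ltr0n.
(* The [k]-th root of the constant in [n ^ (k - 1) <= C * q ^ k]. *)
exists (powR C^-1 k%:R^-1); split; first by rewrite powR_gt0 // invr_gt0.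
exists L => n Ln q m w T tT.
have kn : (2 * k <= n)%N.
  apply: leq_trans Ln; rewrite mulnC leq_mul2l (leq_pexp2l _ (n1 := 1)) ?orbT //.
have n0 : (0 < n)%N by apply: leq_trans Ln.
have M0 : (0 < n %/ L)%N by rewrite divn_gt0.
have cardE : #|{: 'I_(n %/ L) * ('I_k * {ffun 'I_k -> bool}) + 'I_(n %% L)}| = n.
  by rewrite card_sum !card_prod card_ffun card_bool !card_ord -divn_eq.
have bound : n%:R ^+ k'.+1 <= C * q%:R ^+ k.
  apply: (@tester_queries R k' _ _ n cardE _ _ _ _ _ kn (leq_div _ _) _ tT).
  move=> D s eD B kB; have := hdist_hard cardE s eD kB; set h := hdist _ _ => hB.
  rewrite mulrC ltr_pdivrMr ?mulr_gt0 ?ltr0n // -!natrM ltr_nat.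
  have := ltn_pmod n L0; have := divn_eq n L; nia.
have k0 : k%:R != 0 :> R by rewrite pnatr_eq0.
rewrite -(@ler_pXn2r _ k) ?nnegrE ?mulr_ge0 ?powR_ge0 //.
rewrite exprMn -!powR_mulrn ?powR_ge0 // -!powRrM mulVf // powRr1 ?invr_ge0 ?(ltW C0) //.
have -> : (1 - k%:R^-1) * k%:R = k'.+1%:R :> R.
  by rewrite mulrBl mul1r mulVf // -[k]addn1 natrD addrK.
by rewrite !powR_mulrn // mulrC ler_pdivrMr // mulrC.
Qed.
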